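(* Let $g\in{\cal H}_d$ with $|a|<1$, where $a=\det Dg$. Let $V\subset{\bf C}^2$ be compact with $K\subset\mathrm{int}\,V$, $g(J^+\cap V)\subset J^+\cap V$ and $g^{-1}(J^-\cap V)\subset J^-\cap V$, and let $s^-=\lim_{n\to\infty}\frac1n\log\max\{\|Dg^{-n}(p)\|:p\in J^-\cap V\}$. Then $$\overline{dim}_B(K^-\cap V)\le 4-\frac{2\log(|a|^{-1})}{s^-}<4.$$
   Context: A generalized Hénon map is a map $g_i(z,w)=(w,P_i(w)+a_iz)$ of ${\bf C}^2$, where $P_i$ is a complex polynomial of degree $d_i\ge 2$ and $a_i\in{\bf C}\setminus\{0\}$. For $d\ge 2$, ${\cal H}_d$ denotes the set of all finite compositions $g=g_1\circ\cdots\circ g_m$ of generalized Hénon maps with $d_1\cdots d_m=d$; $\det Dg$ is constant, equal to $a=a_1\cdots a_m$. $K^\pm$ is the set of points whose forward ($+$) resp. backward ($-$) orbit under $g$ is bounded, $K=K^+\cap K^-$, $J^\pm=\partial K^\pm$. $\overline{dim}_B$ denotes upper box-counting dimension (of a bounded subset of ${\bf C}^2={\bf R}^4$). *)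

(* Defs.v *)
From Stdlib Require Import Reals List.
From Coquelicot Require Import Coquelicot.
Open Scope R_scope.

(* C^2 = R^4, normed (Euclidean) module over C_AbsRing *)
Definition C2 : NormedModule C_AbsRing :=
  prod_NormedModule C_AbsRing C_NormedModule C_NormedModule.

Fixpoint Peval (P : list C) (x : C) : C :=
  match P with
  | nil => RtoC 0
  | c :: P' => Cplus c (Cmult x (Peval P' x))
  end.

Definition pdeg (P : list C) : nat := pred (length P).

Definition henon (h : list C * C) (p : C2) : C2 :=
  (snd p, Cplus (Peval (fst h) (snd p)) (Cmult (snd h) (fst p))).

Definition henon_inv (h : list C * C) (p : C2) : C2 :=
  (Cdiv (Cminus (snd p) (Peval (fst h) (fst p))) (snd h), fst p).

Definition henon_ok (h : list C * C) : Prop :=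
  (2 <= pdeg (fst h))%nat /\ last (fst h) (RtoC 0) <> RtoC 0 /\ snd h <> RtoC 0.

Definition hcomp (l : list (list C * C)) : C2 -> C2 :=
  fold_right (fun h f => fun p => henon h (f p)) (fun p => p) l.

Definition hcomp_inv (l : list (list C * C)) : C2 -> C2 :=
  fold_right (fun h f => fun p => f (henon_inv h p)) (fun p => p) l.

Definition hdeg (l : list (list C * C)) : nat :=
  fold_right (fun h acc => (pdeg (fst h) * acc)%nat) 1%nat l.

(* a = a_1 ... a_m = det Dg *)
Definition hjac (l : list (list C * C)) : C :=
  fold_right (fun h acc => Cmult (snd h) acc) (RtoC 1) l.

Definition in_Hd (d : nat) (l : list (list C * C)) : Prop :=
  l <> nil /\ List.Forall henon_ok l /\ hdeg l = d.

Fixpoint iter_map (n : nat) (f : C2 -> C2) (p : C2) : C2 :=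
  match n with O => p | S n' => f (iter_map n' f p) end.

(* points with bounded orbit under f (f = g gives K^+, f = g^{-1} gives K^-) *)
Definition bounded_orbit (f : C2 -> C2) (p : C2) : Prop :=
  exists M : R, forall n, norm (iter_map n f p) <= M.

Definition is_boundary (A : C2 -> Prop) (x : C2) : Prop :=
  (forall eps : R, 0 < eps -> exists y, norm (minus y x) < eps /\ A y) /\
  (forall eps : R, 0 < eps -> exists y, norm (minus y x) < eps /\ ~ A y).

Definition is_interior (A : C2 -> Prop) (x : C2) : Prop :=
  exists eps : R, 0 < eps /\ forall y, norm (minus y x) < eps -> A y.

Definition is_open (A : C2 -> Prop) : Prop := forall x, A x -> is_interior A x.

Definition is_compact (V : C2 -> Prop) : Prop :=
  forall (I : Type) (U : I -> C2 -> Prop),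
    (forall i, is_open (U i)) -> (forall x, V x -> exists i, U i x) ->
    exists li : list I, forall x, V x -> exists i, In i li /\ U i x.

Definition is_opnorm (L : C2 -> C2) (m : R) : Prop :=
  (forall u, norm (L u) <= m * norm u) /\
  (forall m', (forall u, norm (L u) <= m' * norm u) -> m <= m').

Definition is_max_deriv_norm (f : C2 -> C2) (A : C2 -> Prop) (n : nat) (m : R) : Prop :=
  (exists p L, A p /\ filterdiff (iter_map n f) (locally p) L /\ is_opnorm L m) /\
  (forall p L m', A p -> filterdiff (iter_map n f) (locally p) L -> is_opnorm L m' -> m' <= m).

Definition covers (E : C2 -> Prop) (eps : R) (n : nat) : Prop :=
  exists cs : list C2, length cs = n /\
    forall x, E x -> exists c, In c cs /\ norm (minus x c) < eps.

Definition min_cover (E : C2 -> Prop) (eps : R) (n : nat) : Prop :=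
  covers E eps n /\ forall m, covers E eps m -> (n <= m)%nat.

(* upper box-counting dimension:
   limsup_{eps -> 0+} log N(E,eps) / (- log eps)
   = inf_{delta>0} sup_{0<eps<delta} log N(E,eps) / (- log eps) *)
Definition upper_box_dim (E : C2 -> Prop) : Rbar :=
  Rbar_glb (fun r => exists delta : R, 0 < delta /\
    r = Lub_Rbar (fun v => exists (eps : R) (n : nat),
          0 < eps < delta /\ min_cover E eps n /\ v = ln (INR n) / (- ln eps))).

(* Main.v *)
(** Proof idea.  Write f for the inverse of g; it is a polynomial automorphism which multiplies
    Lebesgue measure on R^4 by |a|^(-2) > 1.

    - The points whose f-orbit stays in a fixed cube form a set S with f(S) contained in S and
      finite volume, so S is a null set.  Hence the set K^- of bounded f-orbits is null, it has no
      interior, and K^- /\ V is contained in J^- /\ V.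
    - If s' > s, then for a suitable n the derivative of f^n has norm less than exp(s' n)
      on J^- /\ V.  As f^n is C^2 and J^- /\ V is bounded and f-invariant, f^(kn) maps a delta-ball
      centred on J^- /\ V into a fixed bounded set as long as delta exp(s' k n) <= r.
    - N disjoint balls of radius comparable to delta have volume about N delta^4, and f^(kn)
      multiplies it by |a|^(-2kn); so N delta^4 <= C |a|^(2kn).  With k maximal, |a|^(kn) is
      comparable to delta^(ln(1/|a|) / s'), which bounds the number of delta-separated points.
    - A single point gives 4 - 2 ln(1/|a|) / s' >= 0 for all such s' > 0, hence s > 0. *)

Require Import Defs.
From Stdlib Require Import Reals List Lra Lia Classical.
From Coquelicot Require Import Coquelicot.
From HB Require structures.
From mathcomp Require all_boot all_order all_algebra boolp classical_sets reals Rstruct.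
From mathcomp Require constructive_ereal interval_inference measure measurable_realfun.
From mathcomp Require lebesgue_measure lebesgue_integral ring lra.
Open Scope R_scope.

(** * Hénon maps and cubes *)

Definition nonzero_jac (l : list (list C * C)) : Prop :=
  List.Forall (fun h => snd h <> RtoC 0) l.

Lemma henonK (h : list C * C) (p : C2) :
  snd h <> RtoC 0 -> henon_inv h (henon h p) = p.
Proof.
  intros ha; destruct p as [z w]; unfold henon, henon_inv; cbn [fst snd].
  apply injective_projections; cbn [fst snd]; [|reflexivity].
  match goal with |- ?x = ?y => change (@eq C x y) end; field; exact ha.
Qed.

Lemma hcompK (l : list (list C * C)) (p : C2) :
  nonzero_jac l -> hcomp_inv l (hcomp l p) = p.
Proof.
  intros hl; revert p; induction hl as [|h l hh hl IH]; intros p; [easy|]; cbn.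
  now rewrite henonK.
Qed.

Lemma iter_map_succ (n : nat) (f : C2 -> C2) (p : C2) :
  iter_map (S n) f p = iter_map n f (f p).
Proof. induction n as [|n IH]; [easy|]; simpl in *; now rewrite IH. Qed.

Lemma iter_hcompK (l : list (list C * C)) (n : nat) (p : C2) :
  nonzero_jac l -> iter_map n (hcomp_inv l) (iter_map n (hcomp l) p) = p.
Proof.
  intros hl; revert p; induction n as [|n IH]; intros p; [easy|].
  rewrite iter_map_succ; simpl iter_map; now rewrite hcompK.
Qed.

(** Cubes replace Euclidean balls because they are products of intervals, so that their volume
    follows from the product measure. [cube_norm] and [norm_cube] compare the two at the cost of a
    factor 2. *)
Definition cube (c : C2) (r : R) (x : C2) : Prop :=
  (Rabs (fst (fst x) - fst (fst c)) <= r /\ Rabs (snd (fst x) - snd (fst c)) <= r) /\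
  (Rabs (fst (snd x) - fst (snd c)) <= r /\ Rabs (snd (snd x) - snd (snd c)) <= r).

Lemma norm_C2 (u : C2) :
  norm u = sqrt (((fst (fst u))^2 + (snd (fst u))^2) + ((fst (snd u))^2 + (snd (snd u))^2)).
Proof.
  destruct u as [[a b] [c d]].
  change (norm ((a, b, (c, d)) : C2)) with (sqrt (Cmod (a,b) ^ 2 + Cmod (c,d) ^ 2)).
  unfold Cmod; rewrite !pow2_sqrt; [reflexivity| |]; simpl fst; simpl snd; nra.
Qed.

Lemma sqr_bound (x r : R) : Rabs x <= r -> x ^ 2 <= r ^ 2.
Proof. intros H; rewrite <- (pow2_abs x); apply pow_incr; split; [apply Rabs_pos|exact H]. Qed.

Lemma cube_norm (c : C2) (r : R) (x : C2) : cube c r x -> norm (minus x c) <= 2 * r.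
Proof.
  intros [[H1 H2] [H3 H4]].
  assert (0 <= r) by (apply Rle_trans with (2 := H1); apply Rabs_pos).
  apply sqr_bound in H1, H2, H3, H4.
  destruct x as [[x1 x2] [x3 x4]], c as [[c1 c2] [c3 c4]].
  rewrite norm_C2; cbn in *; unfold plus, opp; cbn.
  rewrite <- (sqrt_pow2 (2 * r)) by lra.
  apply sqrt_le_1_alt; nra.
Qed.

Lemma norm_cube (c : C2) (r : R) (x : C2) : norm (minus x c) <= r -> cube c r x.
Proof.
  intros H; set (u := minus x c) in H.
  assert (A : forall s, s ^ 2 <= norm u ^ 2 -> Rabs s <= r).
  { intros s hs; apply Rle_trans with (2 := H).
    rewrite <- (Rabs_pos_eq (norm u)) by apply norm_ge_0.
    apply Rsqr_le_abs_0; unfold Rsqr; nra. }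
  rewrite norm_C2, pow2_sqrt in A by nra.
  repeat split; apply A; unfold u; rewrite ?Rminus_def; cbn; unfold plus, opp; cbn;
    match goal with |- ?t <= ?a * ?a' + ?b * ?b' + (?c * ?c' + ?d * ?d') => 
     pose proof (Rle_0_sqr a); pose proof (Rle_0_sqr b);
     pose proof (Rle_0_sqr c); pose proof (Rle_0_sqr d) end; unfold Rsqr in *; lra.
Qed.

Lemma Rabs_sub_le (x c r : R) : Rabs (x - c) <= r <-> c - r <= x /\ x <= c + r.
Proof. split_Rabs; lra. Qed.

Lemma cubes_meet (c c' : C2) (r : R) (x : C2) :
  cube c r x -> cube c' r x -> norm (minus c c') <= 4 * r.
Proof.
  intros H H'; apply cube_norm in H, H'.
  replace (minus c c') with (plus (minus c x) (minus x c')).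
  2: now unfold minus; rewrite <- plus_assoc, (plus_assoc (opp x)), plus_opp_l, plus_zero_l.
  apply Rle_trans with (1 := norm_triangle _ _).
  rewrite <- (opp_minus x c), norm_opp; lra.
Qed.

Lemma Cmod_sqr (a : C) : Cmod a ^ 2 = fst a ^ 2 + snd a ^ 2.
Proof. unfold Cmod; apply pow2_sqrt; nra. Qed.

Lemma norm_cube_zero (M : R) (x : C2) : norm x <= M -> cube zero M x.
Proof.
  intros H; apply norm_cube; apply Rle_trans with (2 := H), Req_le.
  rewrite !norm_C2; cbn; unfold plus, opp; cbn; f_equal; ring.
Qed.

Lemma hjac_nonzero (l : list (list C * C)) : nonzero_jac l -> hjac l <> RtoC 0.
Proof.
  induction 1 as [|h l hh _ IH]; [exact C1_nz|].
  now apply Cmult_neq_0.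
Qed.

(** * Volume *)

Module Volume.
Import HB.structures.
Import all_boot all_order all_algebra boolp classical_sets reals Rstruct.
Import constructive_ereal interval_inference measure measurable_realfun.
Import lebesgue_measure lebesgue_integral ring lra.
Import Order.TTheory GRing.Theory Num.Theory.
Local Open Scope classical_set_scope.
Local Open Scope ring_scope.

(** Uniqueness of Lebesgue measure: [|a|] times its pushforward under the map agrees with it on the
    intervals []x, y]], hence on all measurable sets. *)
Lemma lebesgue_affine (R : realType) (p a : R) (A : set (measurableTypeR R)) :
  a != 0 -> measurable A ->
  lebesgue_measure ((fun x : measurableTypeR R => p + a * x : measurableTypeR R) @^-1` A)
    = (`|a|^-1%:E * lebesgue_measure A)%E.
Proof.
move=> a0 mA.
set f := (fun x : measurableTypeR R => p + a * x : measurableTypeR R).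
have mf : measurable_fun setT f by apply: measurable_funD => //; apply: measurable_funM.
pose r : {nonneg R} := NngNum (normr_ge0 a).
pose mu : {measure set (measurableTypeR R) -> \bar R} := lebesgue_measure.
pose nu := measure_function_pushforward__canonical__measure_function_Measure mu mf.
have H : (forall X, ocitv X -> mu X = mscale r nu X) -> mu A = mscale r nu A.
  by move=> E; exact: (@lebesgue_measure_unique _ (mscale r nu) E A mA).
rewrite -/mu H => [|_ [[x y] _ <-]].
  by rewrite /mscale /= muleA -EFinM mulVf ?mul1e// normr_eq0.
rewrite /mscale /mu /= /pushforward /preimage /f /=.
have [a_gt0|a_lt0|a_eq0] := ltrgt0P a; last by rewrite a_eq0 eqxx in a0.
- have -> : [set z | p + a * z \in `]x, y]] = `](x - p) / a, (y - p) / a]%classic.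
    apply/seteqP; split=> z /=; rewrite !in_itv /= ltr_pdivrMr// ler_pdivlMr//;
      by move=> /andP[? ?]; apply/andP; split; lra.
  rewrite !lebesgue_measure_itv /= !lte_fin ltr_pM2r ?invr_gt0// ltrD2r.
  case: ifP => xy; last by rewrite mule0.
  by rewrite -!EFinB -EFinM; congr EFin; field.
(* A negative slope exchanges the ends, so the preimage is closed on the left and open on the
   right. *)
- have -> : [set z | p + a * z \in `]x, y]] =
      [set` Interval (BLeft ((y - p) / a)) (BLeft ((x - p) / a))].
    apply/seteqP; split=> z /=; rewrite !in_itv /= ler_ndivrMr// ltr_ndivlMr//;
      by move=> /andP[? ?]; apply/andP; split; lra.
  rewrite !lebesgue_measure_itv /= !lte_fin ltr_nM2r ?invr_lt0// ltrD2r.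
  case: ifP => xy; last by rewrite mule0.
  by rewrite -!EFinB -EFinM; congr EFin; field.
Qed.

(* The section at [w] of the preimage of [B] is the preimage under [tau (_, w)] of the section
   of [B] at [w]: integrate over [w]. *)
Lemma product_skew d (T : measurableType d) (R : realType)
    (m : {sigma_finite_measure set T -> \bar R}) (tau : T * T -> T) (c : R) :
  0 <= c -> measurable_fun setT tau ->
  (forall w S, measurable S -> m ((fun z => tau (z, w)) @^-1` S) = (c%:E * m S)%E) ->
  forall B, measurable B ->
  (m \x m)%E ((fun p => (p.2, tau p)) @^-1` B) = (c%:E * (m \x m)%E B)%E.
Proof.
move=> c0 mtau Htau B mB.
have mh : measurable_fun setT (fun p : T * T => (p.2, tau p)).
  by apply: measurable_fun_pair.
have mhB : measurable ((fun p : T * T => (p.2, tau p)) @^-1` B).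
  by rewrite -[X in measurable X]setTI; exact: mh.
(* The variable [w] is the second coordinate of the source but the first of the target, so the left
   side has to be integrated in the other order. *)
have -> : (m \x m)%E ((fun p => (p.2, tau p)) @^-1` B) =
          (m \x^ m)%E ((fun p => (p.2, tau p)) @^-1` B).
  by apply: product_measure_unique => //= ? ? ? ?; rewrite product_measure2E.
rewrite /product_measure2 /product_measure1 -ge0_integralZl//=; last first.
  exact: measurable_fun_xsection.
apply: eq_integral => w _ /=.
rewrite -(Htau w); last exact: measurable_xsection.
congr (m _); apply/seteqP; split => z /=; by rewrite /ysection /xsection /= !inE.
Qed.

(** A named copy of planar Lebesgue measure, to which the structures needed for applying
    [product_skew] once more, over the complex plane, are attached. *)
Definition area (R : realType) : set (measurableTypeR R * measurableTypeR R)%type -> \bar R :=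
  (lebesgue_measure \x lebesgue_measure)%E.

HB.instance Definition _ (R : realType) := Measure.on (area R).

(* The sigma-finite structure which the library declares for [\x] only applies to
   subprobabilities. *)
Lemma area_sigma_finite (R : realType) : sigma_finite setT (area R).
Proof.
have /sigma_finiteP[F [TF ndF Foo]] := sigma_finiteT (@lebesgue_measure R).
exists (fun n => F n `*` F n) => [|n].
  apply/seteqP; split => // -[x y] _.
  have [[n _ Fx] [m _ Fy]] : (\bigcup_n F n) x /\ (\bigcup_n F n) y by rewrite -TF.
  exists (maxn n m) => //; split => /=.
    exact: subsetPset (ndF _ _ (leq_maxl n m)) _ Fx.
  exact: subsetPset (ndF _ _ (leq_maxr n m)) _ Fy.
have [mF Ffin] := Foo n; split; first exact: measurableX.
by rewrite /area product_measure1E// lte_mul_pinfty// ge0_fin_numE.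
Qed.

HB.instance Definition _ (R : realType) :=
  Measure_isSigmaFinite.Build _ _ _ (area R) (@area_sigma_finite R).

Lemma area_skew (R : realType) (p k c : R) (B : set (measurableTypeR R * measurableTypeR R)%type) :
  c != 0 -> measurable B ->
  area R ((fun z => (z.2, p + k * z.2 + c * z.1)) @^-1` B) = (`|c|^-1%:E * area R B)%E.
Proof.
move=> c0 mB; apply: (@product_skew _ _ R lebesgue_measure
  (fun z : measurableTypeR R * measurableTypeR R => p + k * z.2 + c * z.1 : measurableTypeR R) `|c|^-1) => //.
- by apply: measurable_funD; [apply: measurable_funD => //|]; apply: measurable_funM.
- by move=> w S mS /=; rewrite lebesgue_affine.
Qed.

Lemma measurable_complex_affine (R : realType) (p q a b : R) :
  measurable_fun setT (fun z : measurableTypeR R * measurableTypeR R =>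
    (p + a * z.1 - b * z.2 : measurableTypeR R, q + b * z.1 + a * z.2 : measurableTypeR R)).
Proof.
apply: measurable_fun_pair.
  by apply: measurable_funB; [apply: measurable_funD => //|]; apply: measurable_funM.
by apply: measurable_funD; [apply: measurable_funD => //|]; apply: measurable_funM.
Qed.

(* If [a != 0], the map is the composition of two of the maps of [area_skew]; otherwise
   its linear part i b = (1 + i) (1 + i) b / 2 reduces to that case. *)
Lemma area_complex_affine (R : realType) (p q a b : R)
    (B : set (measurableTypeR R * measurableTypeR R)%type) :
  a ^+ 2 + b ^+ 2 != 0 -> measurable B ->
  area R ((fun z => (p + a * z.1 - b * z.2, q + b * z.1 + a * z.2)) @^-1` B)
    = ((a ^+ 2 + b ^+ 2)^-1%:E * area R B)%E.
Proof.
have main (p' q' a' b' : R) (B' : set (measurableTypeR R * measurableTypeR R)%type) :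
    a' != 0 -> measurable B' ->
    area R ((fun z => (p' + a' * z.1 - b' * z.2, q' + b' * z.1 + a' * z.2)) @^-1` B')
      = ((a' ^+ 2 + b' ^+ 2)^-1%:E * area R B')%E.
  move=> a0 mB.
  have s0 : 0 < a' ^+ 2 + b' ^+ 2.
    by apply: ltr_pwDl; rewrite ?sqr_ge0// exprn_even_gt0.
  (* The inner map yields [(y, u)] with [u] the new real part; eliminating [x] from the new
     imaginary part gives the coefficients of the outer map. The factors [a'] and
     [(a'^2 + b'^2) / a'] multiply to the squared modulus. *)
  rewrite (_ : _ @^-1` _ = (fun z => (z.2, p' + - b' * z.2 + a' * z.1)) @^-1`
      ((fun z => (z.2, q' - b' / a' * p' + b' / a' * z.2
                        + (a' ^+ 2 + b' ^+ 2) / a' * z.1)) @^-1` B')).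
    have mH : measurable_fun setT (fun z : measurableTypeR R * measurableTypeR R =>
        (z.2, (q' - b' / a' * p' + b' / a' * z.2 + (a' ^+ 2 + b' ^+ 2) / a' * z.1)
                : measurableTypeR R)).
      apply: measurable_fun_pair => //.
      by apply: measurable_funD; [apply: measurable_funD => //|]; apply: measurable_funM.
    rewrite area_skew//; last by rewrite -[X in measurable X]setTI; exact: mH.
    rewrite area_skew//; last by rewrite mulf_neq0 ?invr_eq0// gt_eqF.
    rewrite muleA -EFinM; congr (_%:E * _)%E.
    rewrite normrM normfV (gtr0_norm s0) -invfM; congr (_^-1).
    by field; rewrite normr_eq0.
  apply/seteqP; split => -[x y] /=; set u := (X in B' X); set v := (X in _ -> B' X);
    by suff -> : u = v by []; rewrite /u /v; congr pair; field.
move=> ab0 mB; have [a0|a0] := eqVneq a 0; last exact: main.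
have b0 : b != 0 by move: ab0; rewrite a0 expr0n add0r sqrf_eq0.
have b20 : b / 2 != 0 by rewrite mulf_neq0// invr_eq0 pnatr_eq0.
rewrite (_ : _ @^-1` _ = (fun z : measurableTypeR R * measurableTypeR R =>
      (0 + (b / 2) * z.1 - (b / 2) * z.2, 0 + (b / 2) * z.1 + (b / 2) * z.2)) @^-1`
      ((fun z : measurableTypeR R * measurableTypeR R =>
          (p + 1 * z.1 - 1 * z.2, q + 1 * z.1 + 1 * z.2)) @^-1` B)).
  rewrite main//; last first.
    by rewrite -[X in measurable X]setTI; exact: measurable_complex_affine.
  rewrite main ?oner_neq0// muleA -EFinM; congr (_%:E * _)%E; rewrite a0 -invfM; congr (_^-1).
  by field.
apply/seteqP; split => -[x y] /=; set u := (X in B X); set v := (X in _ -> B X);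
  by suff -> : u = v by []; rewrite /u /v a0; congr pair; field.
Qed.

(** * Measurability and volume distortion of Hénon maps *)

Notation mR := (measurableTypeR R).
Notation mC := (mR * mR)%type.
Notation mC2 := (mC * mC)%type.

Lemma measurable_Cplus d (T : measurableType d) (f g : T -> mC) :
  measurable_fun setT f -> measurable_fun setT g ->
  measurable_fun setT (fun x => Cplus (f x) (g x) : mC).
Proof.
move=> mf mg; apply: measurable_fun_pair.
  exact: (measurable_funD (measurableT_comp measurable_fst mf) (measurableT_comp measurable_fst mg)).
exact: (measurable_funD (measurableT_comp measurable_snd mf) (measurableT_comp measurable_snd mg)).
Qed.

Lemma measurable_Cmult d (T : measurableType d) (f g : T -> mC) :
  measurable_fun setT f -> measurable_fun setT g ->
  measurable_fun setT (fun x => Cmult (f x) (g x) : mC).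
Proof.
move=> mf mg; have mf1 := measurableT_comp measurable_fst mf.
have mf2 := measurableT_comp measurable_snd mf.
have mg1 := measurableT_comp measurable_fst mg.
have mg2 := measurableT_comp measurable_snd mg.
apply: measurable_fun_pair.
  exact: (measurable_funB (measurable_funM mf1 mg1) (measurable_funM mf2 mg2)).
exact: (measurable_funD (measurable_funM mf1 mg2) (measurable_funM mf2 mg1)).
Qed.

Lemma measurable_Copp d (T : measurableType d) (f : T -> mC) :
  measurable_fun setT f -> measurable_fun setT (fun x => Copp (f x) : mC).
Proof.
move=> mf; apply: measurable_fun_pair.
  exact: (measurable_funN (measurableT_comp measurable_fst mf)).
exact: (measurable_funN (measurableT_comp measurable_snd mf)).
Qed.

Lemma measurable_Peval d (T : measurableType d) (P : list C) (f : T -> mC) :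
  measurable_fun setT f -> measurable_fun setT (fun x => Peval P (f x) : mC).
Proof.
move=> mf; elim: P => [|c P IH]; first exact: measurable_cst.
by apply: measurable_Cplus; [exact: measurable_cst|exact: measurable_Cmult].
Qed.

Lemma measurable_henon (h : list C * C) : measurable_fun setT (henon h : mC2 -> mC2).
Proof.
apply: measurable_fun_pair; first exact: measurable_snd.
apply: measurable_Cplus; first by apply: measurable_Peval; exact: measurable_snd.
by apply: measurable_Cmult; [exact: measurable_cst|exact: measurable_fst].
Qed.

Lemma measurable_henon_inv (h : list C * C) :
  measurable_fun setT (henon_inv h : mC2 -> mC2).
Proof.
apply: measurable_fun_pair; last exact: measurable_fst.
apply: measurable_Cmult; last exact: measurable_cst.
apply: measurable_Cplus; first exact: measurable_snd.
by apply: measurable_Copp; apply: measurable_Peval; exact: measurable_fst.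
Qed.

Lemma measurable_hcomp_inv (l : list (list C * C)) :
  measurable_fun setT (hcomp_inv l : mC2 -> mC2).
Proof.
elim: l => [|h l IH]; first exact: measurable_id.
exact: (measurableT_comp IH (measurable_henon_inv h)).
Qed.

Lemma measurable_hcomp (l : list (list C * C)) :
  measurable_fun setT (hcomp l : mC2 -> mC2).
Proof.
elim: l => [|h l IH]; first exact: measurable_id.
exact: (measurableT_comp (measurable_henon h) IH).
Qed.

Lemma measurable_iter_map (f : C2 -> C2) (n : nat) :
  measurable_fun setT (f : mC2 -> mC2) -> measurable_fun setT (iter_map n f : mC2 -> mC2).
Proof.
move=> mf; elim: n => [|n IH]; first exact: measurable_id.
exact: (measurableT_comp mf IH).
Qed.

Definition vol : set mC2 -> \bar R := (area R \x area R)%E.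

HB.instance Definition _ := Measure.on vol.

(** The squared modulus is the real Jacobian of multiplication by [a]. *)
Definition sqmod (a : C) : R := a.1 ^+ 2 + a.2 ^+ 2.

Lemma sqmod_mul (a b : C) : sqmod (Cmult a b) = sqmod a * sqmod b.
Proof.
case: a b => [a1 a2] [b1 b2].
change ((a1 * b1 - a2 * b2) ^+ 2 + (a1 * b2 + a2 * b1) ^+ 2
  = (a1 ^+ 2 + a2 ^+ 2) * (b1 ^+ 2 + b2 ^+ 2)); ring.
Qed.

Lemma sqmod_gt0 (a : C) : a <> RtoC 0%R -> 0 < sqmod a.
Proof.
case: a => [x y] a0; rewrite lt_neqAle addr_ge0 ?sqr_ge0// andbT eq_sym.
apply/negP; rewrite paddr_eq0 ?sqr_ge0// !sqrf_eq0 /= => /andP[/eqP x0 /eqP y0].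
by apply: a0; rewrite x0 y0.
Qed.

(** For fixed [w] the second coordinate is a complex affine map of [z] with slope [a], so
    [product_skew] over the complex plane applies with the factor from [area_complex_affine]. *)
Lemma vol_henon (h : list C * C) (B : set mC2) :
  h.2 <> RtoC 0%R -> measurable B ->
  vol ((henon h : mC2 -> mC2) @^-1` B) = ((sqmod h.2)^-1%:E * vol B)%E.
Proof.
move=> h0 mB; have s0 := sqmod_gt0 _ h0.
apply: (@product_skew _ _ R (area R)
  (fun z : mC2 => Cplus (Peval h.1 z.2) (Cmult h.2 z.1) : mC)) => //.
- by rewrite invr_ge0 ltW.
- exact: (measurableT_comp measurable_snd (measurable_henon h)).
- move=> w S mS /=.
  rewrite -(@area_complex_affine _ (Peval h.1 w).1 (Peval h.1 w).2)//; last first.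
    by rewrite gt_eqF.
  congr (area R _); apply/seteqP; split => z /=; set u := (X in S X); set v := (X in _ -> S X);
    suff -> : u = v by []; rewrite /u /v.
    change (((Peval h.1 w).1 + (h.2.1 * z.1 - h.2.2 * z.2),
             (Peval h.1 w).2 + (h.2.1 * z.2 + h.2.2 * z.1))
       = ((Peval h.1 w).1 + h.2.1 * z.1 - h.2.2 * z.2,
          (Peval h.1 w).2 + h.2.2 * z.1 + h.2.1 * z.2)); congr pair; ring.
  change (((Peval h.1 w).1 + h.2.1 * z.1 - h.2.2 * z.2,
          (Peval h.1 w).2 + h.2.2 * z.1 + h.2.1 * z.2) =
       ((Peval h.1 w).1 + (h.2.1 * z.1 - h.2.2 * z.2),
             (Peval h.1 w).2 + (h.2.1 * z.2 + h.2.2 * z.1))); congr pair; ring.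
Qed.

Lemma vol_hcomp (l : list (list C * C)) (B : set mC2) :
  nonzero_jac l -> measurable B ->
  vol ((hcomp l : mC2 -> mC2) @^-1` B) = ((sqmod (hjac l))^-1%:E * vol B)%E.
Proof.
move=> hl; elim: hl B => [|h {}l hh hl IH] B mB.
  have -> : sqmod (hjac nil) = 1.
    by change (1 ^+ 2 + 0 ^+ 2 = 1 :> R); rewrite expr1n expr0n addr0.
  by rewrite invr1 mul1e.
rewrite (_ : _ @^-1` B = (hcomp l : mC2 -> mC2) @^-1` ((henon h : mC2 -> mC2) @^-1` B))//.
rewrite IH; last by rewrite -[X in measurable X]setTI; exact: measurable_henon.
by rewrite vol_henon// muleA -EFinM /= sqmod_mul invfM mulrC.
Qed.

Lemma vol_iter_hcomp (l : list (list C * C)) (n : nat) (B : set mC2) :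
  nonzero_jac l -> measurable B ->
  vol ((iter_map n (hcomp l) : mC2 -> mC2) @^-1` B)
    = (((sqmod (hjac l))^-1 ^+ n)%:E * vol B)%E.
Proof.
move=> hl; elim: n B => [|n IH] B mB; first by rewrite expr0 mul1e.
rewrite (_ : _ @^-1` B =
  (iter_map n (hcomp l) : mC2 -> mC2) @^-1` ((hcomp l : mC2 -> mC2) @^-1` B))//.
rewrite IH; last by rewrite -[X in measurable X]setTI; exact: measurable_hcomp.
by rewrite vol_hcomp// muleA -EFinM exprSr.
Qed.

Lemma cube_itv (c : C2) (r : R) : (cube c r : set mC2) =
  (`[c.1.1 - r, c.1.1 + r] `*` `[c.1.2 - r, c.1.2 + r]) `*`
  (`[c.2.1 - r, c.2.1 + r] `*` `[c.2.2 - r, c.2.2 + r]).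
Proof.
have E (x y : R) : Rle (Rabs (Rminus x y)) r <-> x \in `[y - r, y + r].
  rewrite Rabs_sub_le in_itv; split.
    by move=> [/RleP H1 /RleP H2]; apply/andP.
  by move=> /andP[/RleP H1 /RleP H2].
by apply/seteqP; split => -[[x1 x2] [x3 x4]]; rewrite /cube /= !E.
Qed.

Lemma measurable_cube (c : C2) (r : R) : measurable (cube c r : set mC2).
Proof. by rewrite cube_itv; do 2! apply: measurableX; exact: measurable_itv. Qed.

Lemma vol_cube (c : C2) (r : R) : 0 < r -> vol (cube c r) = ((2 * r) ^+ 4)%:E.
Proof.
move=> r0; rewrite cube_itv.
have volE (A B : set mC) : measurable A -> measurable B ->
    vol (A `*` B) = (area R A * area R B)%E.
  exact: product_measure1E.
rewrite volE; [|exact: measurableX|exact: measurableX].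
have areaE (A B : set mR) : measurable A -> measurable B ->
    area R (A `*` B) = (lebesgue_measure A * lebesgue_measure B)%E.
  exact: product_measure1E.
rewrite !areaE ?lebesgue_measure_itv//=.
have E (x : R) : (if ((x - r)%:E < (x + r)%:E)%E then ((x + r)%:E - (x - r)%:E)%E else 0)
    = (2 * r)%:E.
  rewrite lte_fin ifT; last by lra.
  by rewrite -EFinB; congr EFin; ring.
by rewrite !E -!EFinM; congr EFin; ring.
Qed.

(** * The null set of bounded backward orbits *)

(** The countable union over [k] contains every point with bounded backward orbit; the successor
    keeps the side of the cube positive. *)
Definition orbit_in_cube (l : list (list C * C)) (k : nat) : set mC2 :=
  \bigcap_n ((iter_map n (hcomp_inv l) : mC2 -> mC2) @^-1` cube Hierarchy.zero k.+1%:R).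

Lemma measurable_orbit_in_cube l k : measurable (orbit_in_cube l k).
Proof.
apply: bigcapT_measurable => n; rewrite -[X in measurable X]setTI.
apply: measurable_iter_map => //; first exact: measurable_hcomp_inv.
exact: measurable_cube.
Qed.

(** The inverse map sends the set into itself and multiplies volume by [|a|^-2 > 1]; a finite volume
    that does not grow under this must vanish. *)
Lemma vol_orbit_in_cube l k : nonzero_jac l -> 0 < sqmod (hjac l) < 1 ->
  vol (orbit_in_cube l k) = 0%E.
Proof.
move=> hl /andP[s0 s1]; have mS := measurable_orbit_in_cube l k.
have fin : (vol (orbit_in_cube l k) < +oo)%E.
  apply: (@le_lt_trans _ _ (vol (cube Hierarchy.zero k.+1%:R))).
    apply: le_measure; rewrite ?inE//; first exact: measurable_cube.
    by move=> x /(_ 0%N Logic.I).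
  by rewrite vol_cube// ltry.
have : (vol ((hcomp l : mC2 -> mC2) @^-1` orbit_in_cube l k) <= vol (orbit_in_cube l k))%E.
  apply: le_measure; rewrite ?inE//.
    by rewrite -[X in measurable X]setTI; exact: measurable_hcomp.
  (* The orbit of [y] is the orbit of [hcomp l y] without its first term. *)
  move=> y Sy n _; have := Sy n.+1 Logic.I.
  by rewrite /= -/(iter_map n.+1 (hcomp_inv l) (hcomp l y)) iter_map_succ hcompK.
have finS : vol (orbit_in_cube l k) \is a fin_num by rewrite ge0_fin_numE.
rewrite vol_hcomp// -(fineK finS) -EFinM lee_fin ler_pdivrMl// => H.
have : 0 <= fine (vol (orbit_in_cube l k)) by rewrite fine_ge0.
move: (fine _) H => x H x0; congr EFin; apply/eqP; rewrite eq_le x0 andbT.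
rewrite leNgt; apply/negP => x_gt0; move: H.
by rewrite leNgt gtr_pMl// s1.
Qed.

Lemma sqmodE (a : C) : sqmod a = Rpow_def.pow (Cmod a) 2.
Proof. by rewrite Cmod_sqr !RpowE. Qed.

(** Otherwise a cube of positive volume around [x] would be covered by countably many null sets. *)
Lemma unbounded_orbit_dense (l : list (list C * C)) (x : C2) (eps : R) :
  nonzero_jac l -> Rlt (Cmod (hjac l)) 1 -> Rlt 0 eps ->
  exists y : C2, Rlt (norm (minus y x)) eps /\ ~ bounded_orbit (hcomp_inv l) y.
Proof.
move=> hl a1 /RltP; rewrite R0E => e0; apply: contrapT => H.
have s01 : 0 < sqmod (hjac l) < 1.
  rewrite sqmod_gt0; last exact: hjac_nonzero.
  rewrite sqmodE RpowE expr_lt1//; first exact/RltP.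
  by apply/RleP; exact: Cmod_ge_0.
(* By [cube_norm], points of this cube are within [2 * eps / 3 < eps] of [x]. *)
have r0 : 0 < eps / 3 by rewrite divr_gt0.
have sub : (cube x (eps / 3) : set mC2) `<=` \bigcup_k orbit_in_cube l k.
  move=> y Hy; have [M HM] : bounded_orbit (hcomp_inv l) y.
    apply: contrapT => nb; apply: H; exists y; split => //.
    apply: (Rle_lt_trans _ _ _ (cube_norm _ _ _ Hy)); apply/RltP.
    have H2 : 2 * (eps / 3) < eps by lra.
    exact: H2.
  have [k Hk] := INR_unbounded M.
  exists k => // n _; apply: norm_cube_zero; apply: Rle_trans (HM n) _.
  apply: (Rle_trans _ (INR k)); first exact: Rlt_le.
  by apply/RleP; rewrite INRE ler_nat.
have : vol (cube x (eps / 3)) = 0%E.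
  apply: measure_negligible; first exact: measurable_cube.
  apply: negligibleS sub _; apply: negligible_bigcup => k.
  exists (orbit_in_cube l k); split => //; first exact: measurable_orbit_in_cube.
  exact: vol_orbit_in_cube.
by rewrite vol_cube// => -[] /eqP; rewrite gt_eqF// exprn_gt0// mulr_gt0.
Qed.

(** * Packing disjoint cubes *)

Definition cubes (cs : list C2) (r : R) : set mC2 := [set x | exists2 c, List.In c cs & cube c r x].

Lemma measurable_cubes cs r : measurable (cubes cs r).
Proof.
elim: cs => [|c cs IH].
  by rewrite (_ : cubes _ _ = set0)//; apply/seteqP; split => // x [].
rewrite (_ : cubes _ _ = (cube c r : set mC2) `|` cubes cs r).
  by apply: measurableU; first exact: measurable_cube.
apply/seteqP; split => x; first by move=> [c' [<-|]]; [left|right; exists c'].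
by move=> [|[c' ? ?]]; [exists c => //; left|exists c' => //; right].
Qed.

(** By [cubes_meet], two intersecting cubes have centres at distance at most [4 * r < delta]; the
    cubes are therefore disjoint and their volumes add up. *)
Lemma vol_cubes (cs : list C2) (r delta : R) : 0 < r -> 4 * r < delta ->
  List.ForallOrdPairs (fun c c' => Rle delta (norm (minus c c'))) cs ->
  vol (cubes cs r) = ((length cs)%:R * (2 * r) ^+ 4)%:E.
Proof.
move=> r0 rd; elim => [|c {}cs sep _ IH].
  rewrite (_ : cubes _ _ = set0) ?measure0 ?mul0r//.
  by apply/seteqP; split => // x [].
rewrite (_ : cubes _ _ = (cube c r : set mC2) `|` cubes cs r); last first.
  apply/seteqP; split => x; first by move=> [c' [<-|]]; [left|right; exists c'].
  by move=> [|[c' ? ?]]; [exists c => //; left|exists c' => //; right].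
have -> : vol ((cube c r : set mC2) `|` cubes cs r) = (vol (cube c r) + vol (cubes cs r))%E.
  apply: measureU; [exact: measurable_cube|exact: measurable_cubes|].
  apply/seteqP; split => // x [cx [c' c'cs c'x]].
  have /RleP H1 := cubes_meet _ _ _ _ cx c'x.
  move: sep => /List.Forall_forall/(_ _ c'cs)/RleP H2.
  have H3 : norm (minus c c') <= 4 * r by move: H1; rewrite RmultE IZRposE INRE.
  by move: (lt_le_trans rd (le_trans H2 H3)); rewrite ltxx.
rewrite IH vol_cube// -EFinD; congr EFin; rewrite [length (c :: cs)]/= -natr1; ring.
Qed.

(** The backward iterate carries disjoint cubes around [cs] into one cube of half-side [B] while
    multiplying their total volume by [|a|^(-2k)]; comparing volumes bounds the number of points. *)
Lemma packing (l : list (list C * C)) (k : nat) (cs : list C2) (delta B : R) :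
  nonzero_jac l -> Rlt 0 delta -> Rlt 0 B ->
  List.ForallOrdPairs (fun c c' => Rle delta (norm (minus c c'))) cs ->
  (forall c x : C2, List.In c cs -> Rlt (norm (minus x c)) delta ->
     Rle (norm (iter_map k (hcomp_inv l) x)) B) ->
  Rle (INR (length cs) * delta ^ 4) (((Cmod (hjac l)) ^ 2) ^ k * (5 * B) ^ 4).
Proof.
move=> hl /RltP + /RltP + sep sub; rewrite R0E => d0 B0.
have s0 := sqmod_gt0 _ (hjac_nonzero l hl).
suff : (length cs)%:R * delta ^+ 4 <= sqmod (hjac l) ^+ k * (5 * B) ^+ 4.
  by move=> /RleP; rewrite -sqmodE !RealsE.
(* With [r = delta / 5] the cubes are disjoint, as [4 * r < delta], and lie in the [delta]-balls, as
   [2 * r < delta]. The factor [(5 / 2) ^ 4] later turns the sides [2 * r] and [2 * B] into [delta]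
   and [5 * B]. *)
have [r r5] : exists r : R, delta = 5 * r by exists (delta * 5^-1)%R; field.
have r0 : 0 < r by lra.
have : (vol ((iter_map k (hcomp l) : mC2 -> mC2) @^-1` cubes cs r) <=
        vol (cube Hierarchy.zero B))%E.
  apply: le_measure; rewrite ?inE; [|exact: measurable_cube|].
    rewrite -[X in measurable X]setTI; apply: measurable_iter_map => //.
      exact: measurable_hcomp.
    exact: measurable_cubes.
  move=> y [c ccs /cube_norm yc]; apply: norm_cube_zero.
  rewrite -(iter_hcompK l k y hl); apply: sub ccs _.
  apply: (Rle_lt_trans _ _ _ yc); apply/RltP.
  have H2 : 2 * r < delta by lra.
  exact: H2.
rewrite vol_iter_hcomp//; last exact: measurable_cubes.
rewrite (vol_cubes _ _ delta)//; last by lra.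
rewrite vol_cube// -EFinM lee_fin exprVn ler_pdivrMl ?exprn_gt0// => H.
have := @ler_wpM2l _ ((5 / 2) ^+ 4) _ _ _ H.
rewrite exprn_ge0 ?divr_ge0// => /(_ isT); rewrite r5; congr (_ <= _); by field.
Qed.
End Volume.

(** * Quadratic approximation *)

(** A form of C^2 regularity, uniform on bounded sets and stable under composition and pairing,
    hence easily propagated to polynomial maps. One constant controls both the linear part and the
    quadratic remainder. *)
Definition quad_approx {U V : NormedModule C_AbsRing} (f : U -> V) : Prop :=
  forall B : R, exists K : R, 0 <= K /\ forall p : U, norm p <= B ->
    exists L : U -> V, is_linear L /\ (forall u, norm (L u) <= K * norm u) /\
      forall x, norm x <= B ->
        norm (minus (minus (f x) (f p)) (L (minus x p))) <= K * norm (minus x p) ^ 2.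

Lemma minus_plus_cancel {G : AbelianGroup} (x y : G) : plus (minus x y) y = x.
Proof. unfold minus; now rewrite <- plus_assoc, plus_opp_l, plus_zero_r. Qed.

Lemma norm_minus_self {V : NormedModule C_AbsRing} (x : V) : norm (minus x x) = 0.
Proof. exact (eq_trans (f_equal norm (minus_eq_zero x)) norm_zero). Qed.

Lemma norm_minus_le {V : NormedModule C_AbsRing} (x y : V) :
  norm (minus x y) <= norm x + norm y.
Proof. unfold minus; rewrite <- (norm_opp y); apply norm_triangle. Qed.

Lemma norm_pair_le {U V : NormedModule C_AbsRing} (u : U) (v : V) :
  norm ((u, v) : prod_NormedModule C_AbsRing U V) <= norm u + norm v.
Proof.
  pose proof (norm_ge_0 u); pose proof (norm_ge_0 v).
  change (sqrt (norm u ^ 2 + norm v ^ 2) <= norm u + norm v).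
  rewrite <- (sqrt_pow2 (norm u + norm v)) by lra.
  apply sqrt_le_1_alt; nra.
Qed.

Lemma norm_fst_le {U V : NormedModule C_AbsRing} (p : prod_NormedModule C_AbsRing U V) :
  norm (fst p) <= norm p.
Proof.
  pose proof (norm_ge_0 (fst p)).
  change (norm (fst p) <= sqrt (norm (fst p) ^ 2 + norm (snd p) ^ 2)).
  rewrite <- (sqrt_pow2 (norm (fst p))) at 1 by lra.
  apply sqrt_le_1_alt; nra.
Qed.

Lemma norm_snd_le {U V : NormedModule C_AbsRing} (p : prod_NormedModule C_AbsRing U V) :
  norm (snd p) <= norm p.
Proof.
  pose proof (norm_ge_0 (snd p)).
  change (norm (snd p) <= sqrt (norm (fst p) ^ 2 + norm (snd p) ^ 2)).
  rewrite <- (sqrt_pow2 (norm (snd p))) at 1 by lra.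
  apply sqrt_le_1_alt; nra.
Qed.

Lemma quad_approx_linear {U V : NormedModule C_AbsRing} (f : U -> V) :
  is_linear f -> quad_approx f.
Proof.
  intros hf B; destruct (linear_norm f hf) as [K [hK HK]].
  exists K; split; [lra|]; intros p _; exists f; split; [easy|split; [easy|]].
  intros x _; rewrite (linear_minus f x p hf).
  rewrite norm_minus_self.
  apply Rmult_le_pos; [lra|apply pow2_ge_0].
Qed.

Lemma quad_approx_const {U V : NormedModule C_AbsRing} (c : V) :
  quad_approx (fun _ : U => c).
Proof.
  intros B; exists 0; split; [lra|]; intros p _; exists (fun _ => zero).
  split; [apply is_linear_zero|split].
  - intros u; rewrite norm_zero; lra.
  - intros x _; rewrite (minus_eq_zero c), norm_minus_self; lra.
Qed.

(** On a ball of radius [B] one factor of the quadratic remainder is at most [2 * Rabs B], which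
    leaves a linear bound. *)
Lemma quad_approx_lipschitz {U V : NormedModule C_AbsRing} (f : U -> V) (B : R) :
  quad_approx f -> exists K, 0 <= K /\ forall p x, norm p <= B -> norm x <= B ->
    norm (minus (f x) (f p)) <= K * norm (minus x p).
Proof.
  intros hf; destruct (hf B) as [K [hK HK]].
  exists (K * (1 + 2 * Rabs B)); split.
  { pose proof (Rabs_pos B); nra. }
  intros p x hp hx; destruct (HK p hp) as [L [_ [HL1 HL2]]].
  specialize (HL2 x hx); specialize (HL1 (minus x p)).
  rewrite <- (minus_plus_cancel (minus (f x) (f p)) (L (minus x p))).
  apply Rle_trans with (1 := norm_triangle _ _).
  pose proof (norm_ge_0 (minus x p)); pose proof (norm_minus_le x p).
  pose proof (Rle_abs B).
  apply Rle_trans with (1 := Rplus_le_compat _ _ _ _ HL2 HL1).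
  assert (norm (minus x p) * norm (minus x p) <= 2 * Rabs B * norm (minus x p)) by nra.
  nra.
Qed.

(** The remainder is that of [g] at [f p], at most [G * F ^ 2] times the squared distance since [f]
    is [F]-Lipschitz, plus the image under [M] of the remainder of [f], which contributes
    [G * K]. *)
Lemma quad_approx_comp {U V W : NormedModule C_AbsRing} (f : U -> V) (g : V -> W) :
  quad_approx f -> quad_approx g -> quad_approx (fun x => g (f x)).
Proof.
  intros hf hg B.
  destruct (quad_approx_lipschitz f (Rabs B) hf) as [F [hF HF]].
  destruct (hf B) as [K [hK HK]].
  assert (hz : exists o : U, norm o = 0) by (exists zero; apply norm_zero).
  destruct hz as [o ho].
  (* Comparison with the value at the origin bounds [f] on the ball of radius [B]; [g] is then
     approximated on the ball of radius [B']. *)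
  set (B' := norm (f o) + F * (2 * Rabs B)).
  assert (HB : forall x, norm x <= B -> norm (f x) <= B').
  { intros x hx; pose proof (Rle_abs B); pose proof (Rabs_pos B).
    rewrite <- (minus_plus_cancel (f x) (f o)).
    apply Rle_trans with (1 := norm_triangle _ _).
    assert (H1 : norm (minus (f x) (f o)) <= F * norm (minus x o)).
    { apply HF; lra. }
    assert (H2 := norm_minus_le x o); rewrite ho in H2.
    unfold B'; nra. }
  destruct (hg B') as [G [hG HG]].
  exists (G * K + G * F ^ 2); split; [nra|]; intros p hp.
  destruct (HK p hp) as [L [hL [HL1 HL2]]].
  destruct (HG (f p) (HB p hp)) as [M [hM [HM1 HM2]]].
  exists (fun u => M (L u)); split; [now apply is_linear_comp|split].
  - intros u; apply Rle_trans with (1 := HM1 _).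
    pose proof (norm_ge_0 u); specialize (HL1 u).
    assert (0 <= G * F ^ 2 * norm u) by (apply Rmult_le_pos; nra).
    apply Rle_trans with (G * (K * norm u)); [now apply Rmult_le_compat_l|nra].
  - intros x hx; specialize (HL2 x hx); specialize (HM2 (f x) (HB x hx)).
    assert (HF' : norm (minus (f x) (f p)) <= F * norm (minus x p)).
    { pose proof (Rle_abs B); apply HF; lra. }
    replace (minus (minus (g (f x)) (g (f p))) (M (L (minus x p)))) with
      (plus (minus (minus (g (f x)) (g (f p))) (M (minus (f x) (f p))))
            (M (minus (minus (f x) (f p)) (L (minus x p))))).
    2:{ rewrite (linear_minus M (minus (f x) (f p)) (L (minus x p)) hM).
        symmetry; apply minus_trans. }
    apply Rle_trans with (1 := norm_triangle _ _).
    specialize (HM1 (minus (minus (f x) (f p)) (L (minus x p)))).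
    assert (G * norm (minus (f x) (f p)) ^ 2 <= G * (F * norm (minus x p)) ^ 2).
    { apply Rmult_le_compat_l; [easy|]; apply pow_incr; split; [apply norm_ge_0|easy]. }
    assert (G * norm (minus (minus (f x) (f p)) (L (minus x p)))
      <= G * (K * norm (minus x p) ^ 2)) by now apply Rmult_le_compat_l.
    nra.
Qed.

Lemma quad_approx_pair {U V W : NormedModule C_AbsRing} (f : U -> V) (g : U -> W) :
  quad_approx f -> quad_approx g ->
  quad_approx (fun x => (f x, g x) : prod_NormedModule C_AbsRing V W).
Proof.
  intros hf hg B; destruct (hf B) as [K [hK HK]], (hg B) as [G [hG HG]].
  exists (K + G); split; [lra|]; intros p hp.
  destruct (HK p hp) as [L [hL [HL1 HL2]]], (HG p hp) as [M [hM [HM1 HM2]]].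
  exists (fun u => (L u, M u)); split; [|split].
  - now apply is_linear_prod.
  - intros u; apply Rle_trans with (1 := norm_pair_le (L u) (M u)).
    specialize (HL1 u); specialize (HM1 u); nra.
  - intros x hx; specialize (HL2 x hx); specialize (HM2 x hx).
    change (norm ((minus (minus (f x) (f p)) (L (minus x p)),
                   minus (minus (g x) (g p)) (M (minus x p)))
                   : prod_NormedModule C_AbsRing V W) <= (K + G) * norm (minus x p) ^ 2).
    apply Rle_trans with (1 := norm_pair_le _ _); nra.
Qed.

Lemma Cmod_fst_le (u : C2) : Cmod (fst u) <= norm u.
Proof. exact (norm_fst_le u). Qed.

Lemma Cmod_snd_le (u : C2) : Cmod (snd u) <= norm u.
Proof. exact (norm_snd_le u). Qed.

(** The remainder of a product is exactly the product of the increments, which accounts for the 1 in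
    the constant; the term [2 * Rabs B] bounds the linear part. *)
Lemma quad_approx_Cmult :
  quad_approx (fun p : C2 => Cmult (fst p) (snd p) : C_NormedModule).
Proof.
  intros B; exists (1 + 2 * Rabs B); split; [pose proof (Rabs_pos B); lra|].
  intros p hp; pose proof (Rle_abs B).
  assert (HL : forall u : C2,
    Cmod (Cplus (Cmult (fst p) (snd u)) (Cmult (snd p) (fst u))) <= 2 * Rabs B * norm u).
  { intros u; apply Rle_trans with (1 := Cmod_triangle _ _); rewrite !Cmod_mult.
    assert (Cmod (fst p) * Cmod (snd u) <= Rabs B * norm u).
    { apply Rmult_le_compat; try apply Cmod_ge_0; [|apply Cmod_snd_le].
      apply Rle_trans with (1 := Cmod_fst_le p); lra. }
    assert (Cmod (snd p) * Cmod (fst u) <= Rabs B * norm u).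
    { apply Rmult_le_compat; try apply Cmod_ge_0; [|apply Cmod_fst_le].
      apply Rle_trans with (1 := Cmod_snd_le p); lra. }
    lra. }
  assert (HL' : forall u : C2,
    Cmod (Cplus (Cmult (fst p) (snd u)) (Cmult (snd p) (fst u))) <= (1 + 2 * Rabs B) * norm u).
  { intros u; pose proof (norm_ge_0 u); specialize (HL u); lra. }
  exists (fun u => Cplus (Cmult (fst p) (snd u)) (Cmult (snd p) (fst u))); split; [split|split].
  - intros u v; cbn; unfold plus; cbn; ring.
  - intros k u; cbn; unfold scal; cbn; unfold mult; cbn; ring.
  - exists (1 + 2 * Rabs B); split; [pose proof (Rabs_pos B); lra|exact HL'].
  - exact HL'.
  - intros x _; set (u := minus x p).
    assert (E : (fst x * snd x - fst p * snd p - (fst p * snd u + snd p * fst u)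
      = fst u * snd u)%C).
    { unfold u; cbn; unfold minus, plus, opp; cbn; ring. }
    change (Cmod (fst x * snd x - fst p * snd p - (fst p * snd u + snd p * fst u))%C
      <= (1 + 2 * Rabs B) * norm u ^ 2).
    rewrite E, Cmod_mult; pose proof (Rabs_pos B).
    assert (Cmod (fst u) * Cmod (snd u) <= norm u * norm u).
    { apply Rmult_le_compat; try apply Cmod_ge_0; [apply Cmod_fst_le|apply Cmod_snd_le]. }
    nra.
Qed.

Lemma quad_approx_plus {U : NormedModule C_AbsRing} (f g : U -> C_NormedModule) :
  quad_approx f -> quad_approx g -> quad_approx (fun x => Cplus (f x) (g x) : C_NormedModule).
Proof.
  intros hf hg.
  apply (quad_approx_comp (fun x => (f x, g x) : C2) (fun p : C2 => plus (fst p) (snd p))).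
  - now apply quad_approx_pair.
  - apply quad_approx_linear, is_linear_plus.
Qed.

Lemma quad_approx_mult {U : NormedModule C_AbsRing} (f g : U -> C_NormedModule) :
  quad_approx f -> quad_approx g -> quad_approx (fun x => Cmult (f x) (g x) : C_NormedModule).
Proof.
  intros hf hg.
  apply (quad_approx_comp (fun x => (f x, g x) : C2)
    (fun p : C2 => Cmult (fst p) (snd p) : C_NormedModule)).
  - now apply quad_approx_pair.
  - apply quad_approx_Cmult.
Qed.

Lemma quad_approx_Peval {U : NormedModule C_AbsRing} (P : list C) (f : U -> C_NormedModule) :
  quad_approx f -> quad_approx (fun x => Peval P (f x) : C_NormedModule).
Proof.
  intros hf; induction P as [|c P IH]; cbn [Peval].
  - apply quad_approx_const.
  - apply quad_approx_plus; [apply quad_approx_const|now apply quad_approx_mult].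
Qed.

Lemma quad_approx_fst {U V : NormedModule C_AbsRing} :
  quad_approx (fun p : prod_NormedModule C_AbsRing U V => fst p).
Proof. apply quad_approx_linear, is_linear_fst. Qed.

Lemma quad_approx_snd {U V : NormedModule C_AbsRing} :
  quad_approx (fun p : prod_NormedModule C_AbsRing U V => snd p).
Proof. apply quad_approx_linear, is_linear_snd. Qed.

Lemma quad_approx_henon_inv (h : list C * C) : quad_approx (henon_inv h).
Proof.
  apply quad_approx_pair; [|apply quad_approx_fst].
  apply quad_approx_mult; [|apply quad_approx_const].
  apply quad_approx_plus; [apply quad_approx_snd|].
  apply (quad_approx_comp (fun p : C2 => Peval (fst h) (fst p) : C_NormedModule) opp).
  - apply quad_approx_Peval, quad_approx_fst.
  - apply quad_approx_linear, is_linear_opp.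
Qed.

Lemma quad_approx_id {U : NormedModule C_AbsRing} : quad_approx (fun x : U => x).
Proof. apply quad_approx_linear, is_linear_id. Qed.

Lemma quad_approx_hcomp_inv (l : list (list C * C)) : quad_approx (hcomp_inv l).
Proof.
  induction l as [|h l IH]; [apply quad_approx_id|].
  exact (quad_approx_comp (henon_inv h) (hcomp_inv l) (quad_approx_henon_inv h) IH).
Qed.

Lemma quad_approx_iter (f : C2 -> C2) (n : nat) : quad_approx f -> quad_approx (iter_map n f).
Proof.
  intros hf; induction n as [|n IH]; [apply quad_approx_id|].
  exact (quad_approx_comp (iter_map n f) f IH hf).
Qed.

(** * Operator norms and expansion near the invariant set *)

(** The supremum of [norm (L u) / norm u] over nonzero [u] is the least bound. *)
Lemma opnorm_exists (L : C2 -> C2) : is_linear L -> exists m, is_opnorm L m.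
Proof.
  intros hL; destruct (linear_norm L hL) as [K [hK HK]].
  destruct (completeness (fun r => exists u, 0 < norm u /\ r = norm (L u) / norm u)) as [m [hm1 hm2]].
  - exists K; intros r [u [hu ->]]; apply Rle_div_l; [easy|apply HK].
  - set (e := ((RtoC 1, RtoC 0) : C2)).
    exists (norm (L e) / norm e), e; split; [|easy].
    unfold e; rewrite norm_C2; cbn; apply sqrt_lt_R0; lra.
  - exists m; split.
    + intros u; destruct (Rle_lt_or_eq_dec 0 (norm u) (norm_ge_0 u)) as [hu|hu].
      * apply Rle_div_l; [easy|]; apply hm1; now exists u.
      * specialize (HK u); rewrite <- hu in *; lra.
    + intros m' hm'; apply hm2; intros r [u [hu ->]]; apply Rle_div_l; [easy|apply hm'].
Qed.

(* The derivative supplied by the quadratic approximation is the Frechet derivative, so its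
   operator norm is bounded by the maximum, and the quadratic remainder is absorbed
   by the gap between [m] and [Lam]. *)
Lemma expansion_near (f : C2 -> C2) (A : C2 -> Prop) (n : nat) (B m Lam : R) :
  quad_approx f -> (forall p, A p -> norm p <= B) ->
  is_max_deriv_norm f A n m -> m < Lam ->
  exists r, 0 < r /\ forall p x, A p -> norm (minus x p) <= r ->
    norm (minus (iter_map n f x) (iter_map n f p)) <= Lam * norm (minus x p).
Proof.
  intros hf hA [_ hmax] hm.
  destruct (quad_approx_iter f n hf (B + 1)) as [K [hK HK]].
  (* The bound 1 keeps [x] in the ball of radius [B + 1] where [K] is valid; the other one gives
     [K * norm (minus x p) <= Lam - m], with [K + 1] in place of [K] to avoid dividing by 0. *)
  exists (Rmin 1 ((Lam - m) / (K + 1))); split.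
  { apply Rmin_pos; [lra|apply Rdiv_lt_0_compat; lra]. }
  assert (hK1 : K * ((Lam - m) / (K + 1)) <= Lam - m).
  { apply Rmult_le_reg_r with (K + 1); [lra|].
    replace (K * ((Lam - m) / (K + 1)) * (K + 1)) with (K * (Lam - m)) by (field; lra); nra. }
  intros p x hp hx; pose proof (hA p hp) as hpB.
  assert (hx1 := Rle_trans _ _ _ hx (Rmin_l _ _)).
  assert (hx2 := Rle_trans _ _ _ hx (Rmin_r _ _)).
  assert (near : forall y, norm (minus y p) <= 1 -> norm y <= B + 1).
  { intros y hy; rewrite <- (minus_plus_cancel y p).
    apply Rle_trans with (1 := norm_triangle _ _); lra. }
  destruct (HK p) as [L [hL [_ HL]]]; [lra|].
  assert (hd : filterdiff (iter_map n f) (locally p) L).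
  { split; [easy|]; intros q hq; apply is_filter_lim_locally_unique in hq; subst q.
    intros eps; apply locally_le_locally_norm.
    assert (he : 0 < Rmin 1 (eps / (K + 1))).
    { apply Rmin_pos; [lra|apply Rdiv_lt_0_compat; [apply cond_pos|lra]]. }
    exists (mkposreal _ he); intros y hy; unfold ball_norm in hy; simpl in hy.
    assert (hy1 := Rlt_le_trans _ _ _ hy (Rmin_l _ _)).
    assert (hy2 := Rlt_le_trans _ _ _ hy (Rmin_r _ _)).
    apply Rle_trans with (1 := HL y (near y (Rlt_le _ _ hy1))).
    pose proof (norm_ge_0 (minus y p)).
    assert (K * norm (minus y p) <= eps).
    { apply Rlt_div_r in hy2; [nra|lra]. }
    nra. }
  destruct (opnorm_exists L hL) as [m' hm'].
  pose proof (hmax p L m' hp hd hm') as hle; destruct hm' as [hm' _].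
  specialize (hm' (minus x p)); specialize (HL x (near x hx1)).
  rewrite <- (minus_plus_cancel (minus (iter_map n f x) (iter_map n f p)) (L (minus x p))).
  apply Rle_trans with (1 := norm_triangle _ _).
  pose proof (norm_ge_0 (minus x p)).
  assert (K * norm (minus x p) <= Lam - m).
  { apply Rle_trans with (2 := hK1); now apply Rmult_le_compat_l. }
  nra.
Qed.

(** * Counting separated points *)

Lemma compact_bounded (V : C2 -> Prop) :
  is_compact V -> exists B, 0 < B /\ forall p, V p -> norm p <= B.
Proof.
  intros hV.
  destruct (hV nat (fun n p => norm p < INR n)) as [ns hns].
  - intros n p hp; exists (INR n - norm p); split; [lra|]; intros y hy.
    rewrite <- (minus_plus_cancel y p).
    apply Rle_lt_trans with (1 := norm_triangle _ _); lra.
  - intros x _; destruct (INR_unbounded (norm x)) as [n hn]; now exists n.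
  (* The successor makes the bound positive even for an empty subcover. *)
  - exists (INR (S (list_max ns))); split; [apply lt_0_INR; lia|].
    intros p hp; destruct (hns p hp) as [n [hn hpn]].
    apply Rlt_le, Rlt_le_trans with (1 := hpn), le_INR.
    assert (H := proj1 (list_max_le ns (list_max ns)) (Nat.le_refl _)).
    rewrite Forall_forall in H; specialize (H n hn); lia.
Qed.

Lemma iter_map_add (m n : nat) (f : C2 -> C2) (p : C2) :
  iter_map (m + n) f p = iter_map m f (iter_map n f p).
Proof. induction m as [|m IH]; [easy|]; simpl; now rewrite IH. Qed.

Lemma iter_map_invariant (A : C2 -> Prop) (f : C2 -> C2) (n : nat) (p : C2) :
  (forall q, A q -> A (f q)) -> A p -> A (iter_map n f p).
Proof. intros hA hp; induction n as [|n IH]; [easy|]; now apply hA. Qed.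

(** As [Lam >= 1], the bound on the last step also keeps all earlier iterates of [x] within [r] of
    the orbit of [p], which stays in [A], so the one-step estimate can be chained. *)
Lemma expansion_iter (f : C2 -> C2) (A : C2 -> Prop) (n k : nat) (Lam r : R) (p x : C2) :
  1 <= Lam -> (forall q, A q -> A (f q)) ->
  (forall q y, A q -> norm (minus y q) <= r ->
     norm (minus (iter_map n f y) (iter_map n f q)) <= Lam * norm (minus y q)) ->
  A p -> norm (minus x p) * Lam ^ k <= r ->
  norm (minus (iter_map (k * n) f x) (iter_map (k * n) f p)) <= Lam ^ k * norm (minus x p).
Proof.
  intros hL hA hexp hp; pose proof (norm_ge_0 (minus x p)) as h0.
  induction k as [|k IH]; intros hk; [simpl; lra|].
  assert (hLk : 1 <= Lam ^ k) by now apply pow_R1_Rle.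
  simpl in hk.
  assert (hk' : norm (minus x p) * Lam ^ k <= r).
  { apply Rle_trans with (2 := hk), Rmult_le_compat_l; nra. }
  specialize (IH hk').
  rewrite Nat.mul_succ_l, Nat.add_comm, !iter_map_add.
  apply Rle_trans with (Lam * norm (minus (iter_map (k * n) f x) (iter_map (k * n) f p))).
  - apply hexp; [now apply iter_map_invariant|lra].
  - simpl; rewrite Rmult_assoc; apply Rmult_le_compat_l; lra.
Qed.

(** Greedy choice: fewer than [n] balls cannot cover [E] by minimality, so a further point of [E]
    lies at distance at least [eps] from all chosen ones. *)
Lemma min_cover_separated (E : C2 -> Prop) (eps : R) (n : nat) :
  min_cover E eps n -> exists cs : list C2, length cs = n /\ List.Forall E cs /\
    ForallOrdPairs (fun c c' => eps <= norm (minus c c')) cs.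
Proof.
  intros [_ hmin].
  assert (H : forall k, (k <= n)%nat -> exists cs : list C2, length cs = k /\ List.Forall E cs /\
    ForallOrdPairs (fun c c' => eps <= norm (minus c c')) cs); [|now apply H].
  induction k as [|k IH]; intros hk.
  { exists nil; repeat split; constructor. }
  destruct IH as [cs [hl [hE hsep]]]; [lia|].
  destruct (classic (forall x, E x -> exists c, In c cs /\ norm (minus x c) < eps)) as [hc|hc].
  - assert (n <= k)%nat by (apply hmin; now exists cs); lia.
  - apply not_all_ex_not in hc; destruct hc as [x hx].
    apply imply_to_and in hx; destruct hx as [hx hfar].
    exists (x :: cs); split; [exact (f_equal S hl)|split; constructor; try easy].
    apply Forall_forall; intros c hc; apply Rnot_lt_le; intros hlt; apply hfar; now exists c.
Qed.

Lemma exp_pow_INR (x : R) (k : nat) : exp x ^ k = exp (INR k * x).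
Proof.
  induction k as [|k IH]; [now rewrite Rmult_0_l, exp_0|].
  rewrite S_INR, Rmult_plus_distr_r, Rmult_1_l, exp_plus, <- IH; simpl; ring.
Qed.

(* With [k] maximal such that [delta * exp (s k n) <= r], the [k n]-th backward iterates of the
   [delta]-balls around [cs] stay in a fixed ball, while their volume is multiplied
   by [a ^ (-2 k n)]. *)
Lemma separated_bound (l : list (list C * C)) (A : C2 -> Prop) (n : nat) (B r s lam : R) :
  nonzero_jac l -> lam = - ln (Cmod (hjac l)) -> 0 < lam -> 0 < s -> (0 < n)%nat ->
  0 < B -> (forall p, A p -> norm p <= B) ->
  (forall q, A q -> A (hcomp_inv l q)) -> 0 < r ->
  (forall q y, A q -> norm (minus y q) <= r ->
     norm (minus (iter_map n (hcomp_inv l) y) (iter_map n (hcomp_inv l) q))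
       <= exp (s * INR n) * norm (minus y q)) ->
  exists C0, forall (delta : R) (cs : list C2), 0 < delta <= r -> cs <> nil -> List.Forall A cs ->
    ForallOrdPairs (fun c c' => delta <= norm (minus c c')) cs ->
    ln (INR (length cs)) <= (4 - 2 * lam / s) * (- ln delta) + C0.
Proof.
  intros hl hlam lam0 s0 hn B0 hB hA r0 hexp.
  set (T := s * INR n) in *.
  assert (T0 : 0 < T) by (apply Rmult_lt_0_compat; [easy|now apply lt_0_INR]).
  (* The constant left after taking logarithms in the packing bound: rounding [D / T] down to [k]
     costs [T], the scale [r] gives [- ln r], and the last term comes from the ball of radius
     [B + r] that contains the images. *)
  exists (2 * lam / s * (T - ln r) + 4 * ln (5 * (B + r))).
  intros delta cs [d0 dr] hne hcs hsep.
  set (D := ln r - ln delta).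
  assert (hD : 0 <= D).
  { unfold D; destruct dr as [dr|dr]; [apply ln_increasing in dr; lra|rewrite dr; lra]. }
  destruct (nfloor_ex (D / T)) as [k [hk1 hk2]].
  { apply Rmult_le_pos; [easy|now apply Rlt_le, Rinv_0_lt_compat]. }
  apply Rle_div_r in hk1; [|easy]; apply Rlt_div_l in hk2; [|easy].
  assert (hpow : delta * exp T ^ k <= r).
  { rewrite <- (exp_ln delta), <- (exp_ln r) by easy.
    rewrite exp_pow_INR, <- exp_plus.
    assert (hle : ln delta + INR k * T <= ln r) by (unfold D in hk1; lra).
    destruct hle as [hlt|heq]; [left; now apply exp_increasing|right; now rewrite heq]. }
  assert (hexp1 : 1 <= exp T) by (pose proof (exp_ineq1 T); lra).
  assert (hpack := Volume.packing l (k * n) cs delta (B + r) hl d0 ltac:(lra) hsep).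
  assert (hLen : 0 < INR (length cs)).
  { destruct cs; [easy|]; apply lt_0_INR; simpl; lia. }
  assert (a0 : 0 < Cmod (hjac l)) by now apply Cmod_gt_0, hjac_nonzero.
  assert (hvol : INR (length cs) * delta ^ 4 <= (Cmod (hjac l) ^ 2) ^ (k * n) * (5 * (B + r)) ^ 4).
  { apply hpack; intros c x hc hx.
    assert (hAc : A c) by (rewrite Forall_forall in hcs; now apply hcs).
    assert (hkx : norm (minus x c) * exp T ^ k <= r).
    { apply Rle_trans with (2 := hpow); apply Rmult_le_compat_r; [|lra].
      apply pow_le; lra. }
    assert (H := expansion_iter _ A n k _ r c x hexp1 hA hexp hAc hkx).
    rewrite <- (minus_plus_cancel (iter_map (k * n) (hcomp_inv l) x)
      (iter_map (k * n) (hcomp_inv l) c)).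
    apply Rle_trans with (1 := norm_triangle _ _).
    assert (norm (iter_map (k * n) (hcomp_inv l) c) <= B) by (apply hB; now apply iter_map_invariant).
    lra. }
  clear hpack; revert hLen hvol; generalize (INR (length cs)); intros N hLen hvol.
  apply ln_le in hvol; [|apply Rmult_lt_0_compat; [easy|now apply pow_lt]].
  rewrite !ln_mult, !ln_pow, mult_INR in hvol by
    (try easy; try lra; repeat apply pow_lt; lra).
  assert (hkn : INR k * INR n = INR k * T / s) by (unfold T; field; lra).
  rewrite hkn in hvol; replace (ln (Cmod (hjac l))) with (- lam) in hvol by lra.
  simpl INR in hvol.
  assert (hkT : 2 * lam / s * (D - T) <= 2 * lam / s * (INR k * T)).
  { apply Rmult_le_compat_l; [|lra].
    apply Rmult_le_pos; [lra|now apply Rlt_le, Rinv_0_lt_compat]. }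
  replace (INR k * T / s * ((1 + 1) * - lam)) with (- (2 * lam / s * (INR k * T))) in hvol
    by (field; lra).
  unfold D in hkT; lra.
Qed.

(** * From counting to box dimension *)

Lemma slope_nonneg (b C0 delta0 : R) :
  0 < delta0 -> (forall delta, 0 < delta <= delta0 -> 0 <= b * (- ln delta) + C0) -> 0 <= b.
Proof.
  intros h0 H; apply Rnot_lt_le; intros hb.
  (* At [delta = exp (- D)] the second bound forces [b * D + C0 <= -1], while the first keeps
     [delta <= delta0]. *)
  set (D := Rmax (- ln delta0) ((C0 + 1) / (- b))).
  assert (hd : exp (- D) <= delta0).
  { rewrite <- (exp_ln delta0) by easy.
    assert (hle : - D <= ln delta0) by (pose proof (Rmax_l (- ln delta0) ((C0 + 1) / (- b))); unfold D; lra).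
    destruct hle as [hlt|heq]; [left; now apply exp_increasing|right; now rewrite heq]. }
  specialize (H (exp (- D)) (conj (exp_pos _) hd)); rewrite ln_exp in H.
  assert (hD : (C0 + 1) / (- b) <= D) by apply Rmax_r.
  apply Rle_div_l in hD; lra.
Qed.

(** The gap [t - b'] times [- ln eps] eventually absorbs the constant [C0], so every [t > b] bounds
    the limsup. *)
Lemma box_dim_le (E : C2 -> Prop) (b : R) :
  0 <= b ->
  (forall t, b < t -> exists b' C0 delta0, b' < t /\ 0 < delta0 /\
    forall eps n, 0 < eps <= delta0 -> min_cover E eps (S n) ->
      ln (INR (S n)) <= b' * (- ln eps) + C0) ->
  Rbar_le (upper_box_dim E) (Finite b).
Proof.
  intros hb H.
  assert (Hle : forall t, b < t -> Rbar_le (upper_box_dim E) (Finite t)).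
  { intros t ht; destruct (H t ht) as [b' [C0 [delta0 [hb' [h0 HC]]]]].
    (* For [eps < exp (- D)] the three bounds give, in turn, [- ln eps > 0], [eps <= delta0] and
       [C0 <= (t - b') * (- ln eps)]. *)
    set (D := Rmax 1 (Rmax (- ln delta0) (C0 / (t - b')))).
    pose proof (Rmax_l 1 (Rmax (- ln delta0) (C0 / (t - b')))) as D1.
    pose proof (Rmax_r 1 (Rmax (- ln delta0) (C0 / (t - b')))) as D2.
    pose proof (Rmax_l (- ln delta0) (C0 / (t - b'))) as D3.
    pose proof (Rmax_r (- ln delta0) (C0 / (t - b'))) as D4.
    fold D in D1, D2.
    apply Rbar_le_trans with (Lub_Rbar (fun v => exists (eps : R) (n : nat),
      0 < eps < exp (- D) /\ min_cover E eps n /\ v = ln (INR n) / (- ln eps))).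
    - apply (proj1 (proj2_sig (Rbar_ex_glb _))).
      exists (exp (- D)); split; [apply exp_pos|reflexivity].
    - apply (proj2 (Lub_Rbar_correct _)).
      intros v [eps [n [[e0 e1] [hn ->]]]]; simpl.
      assert (hln : D < - ln eps).
      { apply ln_increasing in e1; [rewrite ln_exp in e1; lra|easy]. }
      assert (hed : eps <= delta0) by (apply Rlt_le, ln_lt_inv; lra).
      apply Rle_div_l; [lra|].
      destruct n as [|n].
      (* An empty cover means that [E] is empty; [ln] takes the default value 0 at 0, and
         [0 <= b < t] settles the case. *)
      + replace (ln (INR 0)) with 0.
        { apply Rmult_le_pos; lra. }
        simpl; unfold ln; destruct (Rlt_dec 0 0) as [h|h]; [destruct (Rlt_irrefl 0 h)|reflexivity].
      + apply Rle_trans with (1 := HC eps n (conj e0 hed) hn).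
        assert (hC : C0 / (t - b') <= - ln eps) by lra.
        apply Rle_div_l in hC; lra. }
  destruct (upper_box_dim E) as [x| |]; simpl in *.
  - apply le_epsilon; intros e he; apply Hle; lra.
  - apply (Hle (b + 1)); lra.
  - easy.
Qed.

Lemma max_deriv_rate (f : C2 -> C2) (A : C2 -> Prop) (M : nat -> R) (s s' B : R) :
  quad_approx f -> (forall p, A p -> norm p <= B) ->
  (forall n, is_max_deriv_norm f A n (M n)) ->
  is_lim_seq (fun n => ln (M n) / INR n) s -> s < s' ->
  exists n r, (0 < n)%nat /\ 0 < r /\ forall p x, A p -> norm (minus x p) <= r ->
    norm (minus (iter_map n f x) (iter_map n f p)) <= exp (s' * INR n) * norm (minus x p).
Proof.
  intros hf hB hM hlim hs; apply is_lim_seq_spec in hlim.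
  destruct (hlim (mkposreal (s' - s) ltac:(lra))) as [n0 hn0]; simpl in hn0.
  set (n := S n0); specialize (hn0 n ltac:(unfold n; lia)).
  assert (hn : 0 < INR n) by (apply lt_0_INR; unfold n; lia).
  assert (hMn : M n < exp (s' * INR n)).
  (* Only a positive [M n] can be recovered from its logarithm; otherwise the bound is immediate. *)
  { destruct (Rle_or_lt (M n) 0) as [h|h]; [pose proof (exp_pos (s' * INR n)); lra|].
    rewrite <- (exp_ln (M n)) by easy; apply exp_increasing.
    apply Rlt_div_l; [easy|].
    apply Rabs_def2 in hn0; lra. }
  destruct (expansion_near f A n B (M n) _ hf hB (hM n) hMn) as [r [r0 hr]].
  exists n, r; split; [unfold n; lia|now split].
Qed.
Theorem theorem5p2 (d : nat) (l : list (list C * C)) (V : C2 -> Prop)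
  (M : nat -> R) (s : R) :
  (2 <= d)%nat -> in_Hd d l ->
  Cmod (hjac l) < 1 ->
  is_compact V ->
  (forall p, bounded_orbit (hcomp l) p -> bounded_orbit (hcomp_inv l) p ->
     is_interior V p) ->
  (forall p, is_boundary (bounded_orbit (hcomp l)) p -> V p ->
     is_boundary (bounded_orbit (hcomp l)) (hcomp l p) /\ V (hcomp l p)) ->
  (forall p, is_boundary (bounded_orbit (hcomp_inv l)) p -> V p ->
     is_boundary (bounded_orbit (hcomp_inv l)) (hcomp_inv l p) /\ V (hcomp_inv l p)) ->
  (forall n, is_max_deriv_norm (hcomp_inv l)
               (fun p => is_boundary (bounded_orbit (hcomp_inv l)) p /\ V p) n (M n)) ->
  is_lim_seq (fun n => ln (M n) / INR n) s ->
  Rbar_le (upper_box_dim (fun p => bounded_orbit (hcomp_inv l) p /\ V p))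
          (Finite (4 - 2 * ln (/ Cmod (hjac l)) / s)) /\
  4 - 2 * ln (/ Cmod (hjac l)) / s < 4.

Proof.
  intros _ [_ [hok _]] ha hV _ _ hinv hM hlim.
  assert (hl : nonzero_jac l) by (revert hok; apply Forall_impl; now intros h [_ [_ hh]]).
  clear hok; set (f := hcomp_inv l) in *.
  set (J := fun p => is_boundary (bounded_orbit f) p /\ V p) in *.
  destruct (compact_bounded V hV) as [B [B0 hB]].
  assert (hJB : forall p, J p -> norm p <= B) by (intros p [_ hp]; exact (hB p hp)).
  assert (hJinv : forall p, J p -> J (f p)) by (intros p [h1 h2]; exact (hinv p h1 h2)).
  (* A point of [K^-] is approximated by itself from inside and, by density of unbounded orbits,
     from outside. *)
  assert (hEJ : forall p, bounded_orbit f p /\ V p -> J p).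
  { intros p [hp hVp]; split; [split|easy]; intros eps heps.
    - exists p; split; [rewrite norm_minus_self; exact heps|exact hp].
    - exact (Volume.unbounded_orbit_dense l p eps hl ha heps). }
  assert (a0 : 0 < Cmod (hjac l)) by now apply Cmod_gt_0, hjac_nonzero.
  set (lam := ln (/ Cmod (hjac l))).
  assert (hlam : lam = - ln (Cmod (hjac l))) by (now apply ln_Rinv).
  assert (lam0 : 0 < lam).
  { rewrite hlam; pose proof (ln_increasing _ _ a0 ha) as h; rewrite ln_1 in h; lra. }
  assert (hsep : forall s', s < s' -> 0 < s' -> exists C0 r, 0 < r /\
    forall (delta : R) (cs : list C2), 0 < delta <= r -> cs <> nil -> List.Forall J cs ->
      ForallOrdPairs (fun c c' => delta <= norm (minus c c')) cs ->
      ln (INR (length cs)) <= (4 - 2 * lam / s') * (- ln delta) + C0).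
  { intros s' hs' s'0.
    destruct (max_deriv_rate f J M s s' B (quad_approx_hcomp_inv l) hJB hM hlim hs')
      as [n [r [hn [r0 hr]]]].
    destruct (separated_bound l J n B r s' lam hl hlam lam0 s'0 hn B0 hJB hJinv r0 hr) as [C0 hC0].
    now exists C0, r. }
  (* The maximum for [n = 0] is attained, so [J] has a point; a one-point list, separated at every
     scale, makes the slope nonnegative. *)
  assert (hrate : forall s', s < s' -> 0 < s' -> lam <= 2 * s').
  { intros s' hs' s'0; destruct (hsep s' hs' s'0) as [C0 [r [r0 hC]]].
    destruct (hM 0%nat) as [[p [_ [hp _]]] _].
    assert (h : 0 <= 4 - 2 * lam / s').
    { apply (slope_nonneg _ C0 r r0); intros delta hd.
      rewrite <- ln_1; apply (hC delta (p :: nil)); [easy|easy|now constructor|].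
      constructor; constructor. }
    assert (2 * lam <= 4 * s') by (apply Rle_div_l; lra); lra. }
  assert (s0 : lam / 2 <= s).
  { apply Rnot_lt_le; intros hs.
    (* If [s < lam / 2], this midpoint is positive, exceeds [s] and is below [lam / 2], against
       [hrate]; the maximum with 0 covers a negative [s]. *)
    assert (h := hrate ((Rmax s 0 + lam / 2) / 2)).
    assert (Rmax s 0 < lam / 2) by (apply Rmax_lub_lt; lra).
    pose proof (Rmax_l s 0); pose proof (Rmax_r s 0); lra. }
  assert (hb : 0 <= 4 - 2 * lam / s).
  { assert (2 * lam / s <= 4) by (apply Rle_div_l; lra); lra. }
  split.
  2:{ assert (0 < 2 * lam / s) by (apply Rdiv_lt_0_compat; lra); lra. }
  apply box_dim_le; [easy|]; intros t ht.
  set (e := t - (4 - 2 * lam / s)).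
  (* Chosen so that the exponents for [s] and [s'] differ by exactly [e * (s / s')], which is less
     than [e]; the exponent for [s'] is thus below [t]. *)
  set (s' := s + e * s ^ 2 / (2 * lam)).
  assert (hs' : s < s').
  { assert (0 < e * s ^ 2 / (2 * lam)); [|unfold s'; lra].
    apply Rdiv_lt_0_compat; [|lra]; apply Rmult_lt_0_compat; [unfold e; lra|apply pow_lt; lra]. }
  destruct (hsep s' hs') as [C0 [r [r0 hC]]]; [lra|].
  exists (4 - 2 * lam / s'), C0, r; split; [|split; [easy|]].
  - assert (hd : 2 * lam / s - 2 * lam / s' < e); [|unfold e in *; lra].
    replace (2 * lam / s - 2 * lam / s') with (e * (s / s')).
    2:{ unfold s'; field; repeat split; try lra.
        assert (0 < e * s ^ 2) by (apply Rmult_lt_0_compat; [unfold e; lra|apply pow_lt; lra]).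
        nra. }
    assert (s / s' < 1) by (apply Rlt_div_l; lra).
    assert (0 < e) by (unfold e; lra); nra.
  - intros eps n heps hcov.
    destruct (min_cover_separated _ _ _ hcov) as [cs [hlen [hE hcs]]].
    rewrite <- hlen; apply hC; [easy|now destruct cs| |easy].
    revert hE; apply Forall_impl; exact hEJ.
Qed.
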